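(* Let $f$ be a function in the class $\mathcal{F}_0$ and let $k\in\mathbb{N}$, $k\ge 2$. Then $$\sum_{n_1,\ldots,n_k\le x} f((n_1,\ldots,n_k)) = D_{f,k}\, x^k + \begin{cases} O(x^{k-1}), & \text{if } k\ge 3,\\ O(x\log\log x), & \text{if } k=2,\end{cases}$$ where $$D_{f,k} = \sum_p \left(1-\frac1{p^k}\right) \sum_{\nu=1}^{\infty} \frac{f(p^{\nu})}{p^{\nu k}}.$$
   Context: $\mathbb{N}=\{1,2,\ldots\}$, $\mathbb{N}_0=\{0,1,2,\ldots\}$. $(n_1,\ldots,n_k)$ as an argument of $f$ denotes the greatest common divisor; the sum runs over all $k$-tuples of positive integers not exceeding $x$. A function $f:\mathbb{N}\to\mathbb{C}$ is additive if $f(mn)=f(m)+f(n)$ whenever $\gcd(m,n)=1$. The class $\mathcal{F}_0$ consists of the additive functions $f:\mathbb{N}\to\mathbb{C}$ such that $f(p)=1$ for every prime $p$ and such that, for some integer $\ell\in\mathbb{N}_0$, $f(p^\nu)\ll \nu^\ell$ holds uniformly for all primes $p$ and all integers $\nu\ge 2$. $\sum_p$ runs over all primes. The asymptotic formula is for real $x\to\infty$; the implied constant may depend on the fixed data $f$ and $k$. *)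

(* Defs.v *)
From HB Require Import structures.
From mathcomp Require Import all_boot all_order all_algebra.
From mathcomp Require Import complex.
From mathcomp Require Import all_classical all_reals all_analysis.

Set Implicit Arguments.
Unset Strict Implicit.
Unset Printing Implicit Defensive.

Import Order.TTheory GRing.Theory Num.Theory.
Import numFieldNormedType.Exports.

Local Open Scope classical_set_scope.
Local Open Scope ring_scope.
Local Open Scope complex_scope.

(* The complex numbers over R as a normed space over themselves: the alias
   R[i]^o of R[i] carries the topology of the modulus. *)
Notation Cplx R := (R[i]^o).

(* Arithmetic functions have domain {1, 2, ...}; the value at 0 of a function
   on nat is never used. *)
Definition additive_fun (R : realType) (f : nat -> Cplx R) : Prop :=
  forall m n : nat, (0 < m)%N -> (0 < n)%N -> coprime m n ->
    f (m * n)%N = f m + f n.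

Definition classF0 (R : realType) (f : nat -> Cplx R) : Prop :=
  [/\ additive_fun f,
      forall p : nat, prime p -> f p = 1
    & exists (l : nat) (C : R), forall p nu : nat, prime p -> (2 <= nu)%N ->
        `|f (p ^ nu)%N| <= (C * nu%:R ^+ l)%:C].

(* The tuples have entries 1 <= n i <= x, i : 'I_k; 0 is neutral for gcdn. *)
Definition gcd_sum (R : realType) (f : nat -> Cplx R) (k : nat) (x : R)
    : Cplx R :=
  \sum_(n : {ffun 'I_k -> 'I_(Num.truncn x).+1} | [forall i, (0 < n i)%N])
    f (\big[gcdn/0%N]_(i < k) n i).

(* limn is total, so the convergence of the two series below has to be asserted
   separately; the primes are summed in increasing order. *)
Definition inner_term (R : realType) (f : nat -> Cplx R) (k p nu : nat)
    : Cplx R :=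
  f (p ^ nu)%N / (p%:R ^+ (nu * k)).

Definition prime_term (R : realType) (f : nat -> Cplx R) (k p : nat)
    : Cplx R :=
  (1 - (p%:R ^+ k)^-1) * limn (fun N : nat => \sum_(1 <= nu < N) inner_term f k p nu).

Definition Dconst (R : realType) (f : nat -> Cplx R) (k : nat) : Cplx R :=
  limn (fun N : nat => \sum_(0 <= p < N | prime p) prime_term f k p).

(* The filter of neighbourhoods of +oo, packed for the Landau notations. *)
Definition at_infty (R : realType) : filter_on R :=
  FilterType (+oo_R) (@proper_pinfty_nbhs R).

(* Main.v *)
Require Import Defs.
From HB Require Import structures.
From mathcomp Require Import all_boot all_order all_algebra.
From mathcomp Require Import complex.
From mathcomp Require Import all_classical all_reals all_analysis.
From mathcomp Require Import ring lra zify.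

(** Why the theorem holds.  Put g(p^nu) = f(p^nu) - f(p^(nu-1)) and N = floor x.
Additivity gives f(n) = sum of g(q) over the prime powers q dividing n
([additive_fun_sum_pp_diff]), and q divides the gcd of a tuple exactly when it
divides every entry, so that the sum over tuples is the sum over prime powers q
of g(q) floor(N/q)^k ([gcd_sum_prime_powers]).  Summation by parts inside one
prime ([sum_pp_diff_by_parts], [cvg_prime_term]) shows that Dconst is the sum
of g(q)/q^k, the value obtained when floor(N/q) is replaced by x/q and x^k is
factored out.

Only the cost of that replacement is left.  It is at most k (x/q)^(k-1) for
each q ([floor_pow_error]); this holds for q > x too, where the floor vanishes,
so the tail of the series needs no separate treatment.  Since |g(p^nu)| is at
most A nu^l, and the sum of nu^l p^(-e) over nu is O(p^-2) when the exponent e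
starts from 2 at least and grows at least as fast as nu
([sum_pow_prime_powers]), all contributions are
O(x^(k-1)), except that of the primes themselves (nu = 1) for k = 2.  There the
primes p > x contribute at most the sum of (x/p)^2, which is O(x), and the
primes p <= x contribute at most 2x times the sum of 1/p.  The bound
O(log log x) for that sum ([sum_inv_primes_lnln]) is proved by Chebyshev's
argument: the product of the primes between 2^j and 2^(j+1) divides a central
binomial coefficient, hence there are at most 2^(j+1)/j of them, they
contribute at most 2/j to the sum of the inverses, and j runs up to log2 x.

The double series over primes and exponents is never rearranged: all bounds are
proved for truncations p < P, nu < T beyond N, uniformly in P and T, and then
T and P successively go to infinity ([gcd_sum_error]). *)

Set Implicit Arguments.
Unset Strict Implicit.
Unset Printing Implicit Defensive.

Import Order.TTheory GRing.Theory Num.Theory.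
Import numFieldNormedType.Exports.

Local Open Scope classical_set_scope.
Local Open Scope ring_scope.
Local Open Scope complex_scope.

(** * Reduction to prime powers *)

Lemma coprime_prod_primes_lt (e : nat -> nat) (a q : nat) : prime q ->
  coprime (\prod_(a <= p < q | prime p) p ^ e p) q.
Proof.
move=> q_prime; rewrite big_nat_cond.
apply: (big_ind (fun m => coprime m q)) => [|m n cm cn|p].
- exact: coprime1n.
- by rewrite coprimeMl cm.
case/andP=> /andP[_ ltpq] p_prime; apply/coprimeXl.
by rewrite prime_coprime // dvdn_prime2 // neq_ltn ltpq.
Qed.

Lemma additive_fun1 (R : realType) (f : nat -> Cplx R) :
  additive_fun f -> f 1%N = 0.
Proof.
move=> fadd; have := fadd 1%N 1%N isT isT (coprime1n 1).
by rewrite muln1 => /eqP; rewrite -subr_eq0 opprD addrA subrr sub0r oppr_eq0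
  => /eqP.
Qed.

Lemma additive_fun_prod_primes (R : realType) (f : nat -> Cplx R)
    (e : nat -> nat) (P : nat) :
  additive_fun f ->
  f (\prod_(0 <= p < P | prime p) p ^ e p)%N =
  \sum_(0 <= p < P | prime p) f (p ^ e p)%N.
Proof.
move=> fadd; elim: P => [|P IH]; first by rewrite !big_geq // additive_fun1.
rewrite big_mkcond big_nat_recr //= -big_mkcond /=.
rewrite [RHS]big_mkcond big_nat_recr //= -big_mkcond /= -IH.
case: ifP => [P_prime|_]; last by rewrite muln1 addr0.
apply: fadd.
- by rewrite prodn_cond_gt0 // => p p_prime; rewrite expn_gt0 prime_gt0.
- by rewrite expn_gt0 prime_gt0.
by apply: coprimeXr; exact: coprime_prod_primes_lt.
Qed.

Lemma prod_primes_logn (n P : nat) : (0 < n < P)%N ->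
  (\prod_(0 <= p < P | prime p) p ^ logn p n)%N = n.
Proof.
case: P => [|P] /andP[n_gt0]; first by rewrite ltn0.
rewrite ltnS => le_nP; rewrite -[RHS]partnT // (widen_partn _ le_nP).
rewrite big_mkcond [RHS]big_mkcond; apply: eq_bigr => p _ /=.
by rewrite lognE; case: (prime p).
Qed.

(** The values at prime powers of the Moebius transform of an additive [f]; it
vanishes at all other integers. *)
Definition pp_diff (R : realType) (f : nat -> Cplx R) (p nu : nat) : Cplx R :=
  f (p ^ nu)%N - f (p ^ nu.-1)%N.

(** Moebius inversion for additive functions: for each prime the differences
telescope up to the exact power of [p] in [n].  The bounds [P] and [T] only have
to exceed [n], because [p ^ nu %| n] forces both [p] and [nu] to be at most
[n]; the slack is what later allows [P] and [T] to tend to infinity. *)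
Lemma additive_fun_sum_pp_diff (R : realType) (f : nat -> Cplx R)
    (n P T : nat) :
  additive_fun f -> (0 < n)%N -> (n < P)%N -> (n < T)%N ->
  f n = \sum_(0 <= p < P | prime p) \sum_(1 <= nu < T)
    (if (p ^ nu %| n)%N then pp_diff f p nu else 0).
Proof.
move=> fadd n_gt0 ltnP ltnT.
rewrite -{1}(@prod_primes_logn n P) ?n_gt0 // additive_fun_prod_primes //.
apply: eq_bigr => p p_prime; case: T ltnT => // T ltnT.
rewrite big_add1 /=.
rewrite (telescope_sumr_eq (fun i => f (p ^ minn i (logn p n))%N)) //.
  rewrite min0n expn0 additive_fun1 // subr0; congr (f (_ ^ _)%N).
  by apply/esym/minn_idPr; apply: leq_trans (ltnW (ltn_logl p n_gt0)) _.
move=> i _; rewrite pfactor_dvdn // /pp_diff /=.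
case: leqP => [levi|ltiv]; last by rewrite (minn_idPl ltiv).
by rewrite (minn_idPr (leqW levi)) subrr.
Qed.

Lemma card_multiples (N q : nat) : (0 < q)%N ->
  #|[pred m : 'I_N.+1 | (0 < m)%N && (q %| m)%N]| = (N %/ q)%N.
Proof.
move=> q_gt0; rewrite -sum1_card big_mkcond /=.
rewrite -(big_mkord predT (fun m => if (0 < m)%N && (q %| m)%N then 1%N else 0%N)).
elim: N => [|N IH]; first by rewrite big_nat1 div0n.
by rewrite big_nat_recr //= IH divnS // addnC; case: (q %| _)%N.
Qed.

Lemma card_tuples_multiples (N k q : nat) : (0 < q)%N ->
  #|[pred n : {ffun 'I_k -> 'I_N.+1} |
      [forall i, (0 < n i)%N] && (q %| \big[gcdn/0%N]_(i < k) n i)%N]| =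
  ((N %/ q) ^ k)%N.
Proof.
move=> q_gt0; rewrite -(card_multiples N q_gt0).
set M := [pred m : 'I_N.+1 | _]; rewrite -[in RHS](card_ord k) -card_ffun_on.
apply: eq_card => n; rewrite !inE; apply/andP/ffun_onP => [[/forallP n_gt0]|nM].
  by move=> /dvdn_biggcdP qn i; rewrite !inE n_gt0 qn.
split; first by apply/forallP => i; have /andP[] := nM i.
by apply/dvdn_biggcdP => i _; have /andP[] := nM i.
Qed.

(** Exchanging the sums over tuples and over prime powers: a divisor of the gcd
is a common divisor, and the entries are then chosen independently among the
multiples of [p ^ nu]. *)
Lemma gcd_sum_prime_powers (R : realType) (f : nat -> Cplx R) (k P T : nat)
    (x : R) :
  additive_fun f -> (0 < k)%N ->
  (Num.truncn x < P)%N -> (Num.truncn x < T)%N ->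
  gcd_sum f k x = \sum_(0 <= p < P | prime p) \sum_(1 <= nu < T)
    pp_diff f p nu * ((Num.truncn x %/ p ^ nu) ^ k)%:R.
Proof.
move=> fadd; case: k => // k _ ltNP ltNT; rewrite /gcd_sum.
set N := Num.truncn x in ltNP ltNT *.
under eq_bigr => n n_gt0.
  have gcd_gt0 : (0 < \big[gcdn/0%N]_(i < k.+1) n i)%N.
    rewrite big_ord_recl gcdn_gt0; apply/orP; left.
    by move/forallP: n_gt0; apply.
  have gcd_le : (\big[gcdn/0%N]_(i < k.+1) n i <= N)%N.
    rewrite big_ord_recl (leq_trans (dvdn_leq _ (dvdn_gcdl _ _))) //.
      by move/forallP: n_gt0; apply.
    by rewrite -ltnS ltn_ord.
  rewrite (additive_fun_sum_pp_diff fadd gcd_gt0 (leq_ltn_trans gcd_le ltNP)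
    (leq_ltn_trans gcd_le ltNT)); over.
rewrite exchange_big /=; apply: eq_bigr => p p_prime.
rewrite exchange_big /=; apply: eq_bigr => nu _.
rewrite -big_mkcondr /= sumr_const -[LHS]mulr_natr; congr (_ * _%:R).
by apply: card_tuples_multiples; rewrite expn_gt0 prime_gt0.
Qed.

(** * The sum of the inverses of the primes *)

Lemma dvdn_prod_primes (a b m : nat) :
  (forall p, (a <= p < b)%N -> prime p -> (p %| m)%N) ->
  (\prod_(a <= p < b | prime p) p %| m)%N.
Proof.
elim: b => [|b IH] pm; first by rewrite big_geq.
have [leab|ltba] := leqP a b; last by rewrite big_geq.
have {}IH : (\prod_(a <= p < b | prime p) p %| m)%N.
  by apply: IH => p /andP[lap ltpb]; apply: pm; rewrite lap ltnS ltnW.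
rewrite big_mkcond big_nat_recr //= -big_mkcond /=.
case: ifP => [b_prime|_]; last by rewrite muln1.
rewrite Gauss_dvd ?IH ?pm ?leab ?ltnSn //.
have := coprime_prod_primes_lt (fun=> 1%N) a b_prime.
by rewrite (eq_bigr id) // => p _; rewrite expn1.
Qed.

Lemma bin_le_exp2 (n m : nat) : ('C(n, m) <= 2 ^ n)%N.
Proof.
elim: n m => [|n IH] [|m]; rewrite ?bin0 ?bin0n ?expn_gt0 //.
by rewrite binS expnS mul2n -addnn leq_add.
Qed.

Lemma prime_dvd_fact (p n : nat) : prime p -> (p %| n`!)%N -> (p <= n)%N.
Proof.
move=> p_prime; elim: n => [|n IH].
  by rewrite fact0 dvdn1 => /eqP p1; rewrite p1 in p_prime.
rewrite factS Euclid_dvdM // => /orP[/dvdn_leq->//|/IH].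
by move/leq_trans; apply.
Qed.

(** Chebyshev's argument: a prime [p] with [n < p <= 2n] divides [(2n)!] but not
[n!], hence divides the central binomial coefficient, which is at most
[2 ^ 2n]. *)
Lemma prod_primes_double_le (n : nat) :
  (\prod_(n.+1 <= p < n.*2.+1 | prime p) p <= 2 ^ n.*2)%N.
Proof.
have le_n2 : (n <= n.*2)%N by rewrite -addnn leq_addr.
apply: leq_trans (bin_le_exp2 n.*2 n); apply: dvdn_leq.
  by rewrite bin_gt0.
apply: dvdn_prod_primes => p /andP[ltnp lep2] p_prime.
have : (p %| n.*2`!)%N by rewrite dvdn_fact // prime_gt0.
rewrite -(bin_fact le_n2) -[in (n.*2 - n)%N]addnn addnK !Euclid_dvdM //.
by case/or3P => // /(prime_dvd_fact p_prime); rewrite leqNgt ltnp.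
Qed.

(** Each prime of the block exceeds [2 ^ j], so their product is at least
[2 ^ j] to the power of their number; comparing exponents with the bound on
the product gives the count without logarithms. *)
Lemma dyadic_primes_count (j : nat) :
  (j * \sum_((2 ^ j).+1 <= p < (2 ^ j.+1).+1 | prime p) 1 <= 2 ^ j.+1)%N.
Proof.
rewrite -(@leq_exp2l 2) // expnM expn_sum expnS mul2n.
apply: leq_trans (prod_primes_double_le (2 ^ j)).
rewrite big_nat_cond [leqRHS]big_nat_cond; apply: leq_prod => p.
by case/andP=> /andP[/ltnW ltp _] _; rewrite expn1.
Qed.

Lemma sum_inv_primes_dyadic (R : realType) (j : nat) : (0 < j)%N ->
  \sum_((2 ^ j).+1 <= p < (2 ^ j.+1).+1 | prime p) (p%:R^-1 : R) <= 2 / j%:R.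
Proof.
move=> j_gt0; have j0 : 0 < j%:R :> R by rewrite ltr0n.
have p0 : 0 < 2 ^+ j :> R by rewrite exprn_gt0.
apply: (@le_trans _ _ (\sum_((2 ^ j).+1 <= p < (2 ^ j.+1).+1 | prime p)
    (1%:R * (2 ^+ j)^-1 : R))).
  rewrite big_nat_cond [leRHS]big_nat_cond; apply: ler_sum => p.
  case/andP=> /andP[/ltnW ltp _] _.
  rewrite mul1r lef_pV2 ?posrE // ?ltr0n; last first.
    by rewrite (leq_trans _ ltp) // expn_gt0.
  by rewrite -natrX ler_nat.
rewrite -mulr_suml -natr_sum ler_pdivrMr // mulrAC ler_pdivlMr //.
by rewrite mulrC -exprS -natrX -natrM ler_nat dyadic_primes_count.
Qed.

Lemma harmonic_le_ln (R : realType) (J : nat) : (0 < J)%N ->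
  \sum_(1 <= j < J.+1) (j%:R^-1 : R) <= 1 + ln J%:R.
Proof.
elim: J => // -[_ _|J IH _]; first by rewrite big_nat1 ln1 addr0 invr1.
rewrite big_nat_recr //= (le_trans (lerD (IH isT) (lexx _))) // -addrA lerD2l.
have J0 : 0 < J.+1%:R :> R by rewrite ltr0n.
have J1 : 0 < J.+2%:R :> R by rewrite ltr0n.
have -> : J.+1%:R = J.+2%:R * (1 + - J.+2%:R^-1) :> R.
  by rewrite mulrDr mulr1 mulrN divff ?gt_eqF // -[J.+2]addn1 natrD addrK.
have lt1 : J.+2%:R^-1 < 1 :> R by rewrite invf_lt1 // ltr1n.
rewrite lnM ?posrE ?subr_gt0 //.
have := @le_ln1Dx R (- J.+2%:R^-1); rewrite ltrN2 => /(_ lt1).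
by rewrite -addrA gerDl -lerBrDr sub0r.
Qed.

Lemma sum_inv_primes_pow2 (R : realType) (J : nat) :
  \sum_(0 <= p < (2 ^ J.+1).+1 | prime p) (p%:R^-1 : R) <=
  1 + \sum_(1 <= j < J.+1) 2 / j%:R.
Proof.
elim: J => [|J IH].
  rewrite [X in 1 + X]big_geq // addr0 expn1 big_mkcond !big_nat_recr ?big_geq //=.
  by rewrite !add0r invf_le1 ?ltr0n // ler1n.
rewrite (@big_cat_nat _ _ _ (2 ^ J.+1).+1) //=; last by rewrite ltnS leq_exp2l.
by rewrite [in leRHS]big_nat_recr //= addrA lerD ?sum_inv_primes_dyadic.
Qed.

(** The dyadic blocks up to [x] are numbered by [j <= log2 x], so the
contributions [2 / j] add up to a harmonic sum of size [ln (log2 x)]. *)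
Lemma sum_inv_primes_lnln (R : realType) : exists C : R, 0 <= C /\
  exists x0 : R, forall x : R, x0 <= x ->
  [/\ 1 <= x, 1 <= ln (ln x) &
    \sum_(0 <= p < (Num.truncn x).+1 | prime p) (p%:R^-1 : R) <= C * ln (ln x)].
Proof.
have ln2 : 0 < ln 2 :> R by rewrite ln_gt0 // ltr1n.
(* [c] is the constant by which [ln (log2 x)] differs from [ln (ln x)]. *)
set c : R := ln (ln 2).
exists (5 + 2 * `|c|); split; first by rewrite addr_ge0 // mulr_ge0.
(* From this point on [ln (ln x)] is at least 1 and absorbs constants. *)
exists (expR (expR 1)) => x lex.
have x_gt0 : 0 < x by apply: lt_le_trans lex; exact: expR_gt0.
have le_lnx : expR 1 <= ln x by rewrite -ler_expR lnK ?posrE.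
have lnx_gt0 : 0 < ln x by apply: lt_le_trans le_lnx; exact: expR_gt0.
have le_lnlnx : 1 <= ln (ln x) by rewrite -ler_expR lnK ?posrE.
set N := Num.truncn x; set J := trunc_log 2 N.
have leNx : N%:R <= x by rewrite truncn_le ltW.
have x_ge2 : 2 <= x.
  apply: le_trans lex; apply: le_trans (expR_ge1Dx _).
  by have := expR_ge1Dx (1 : R); lra.
have N_ge2 : (2 <= N)%N by rewrite truncn_ge_nat // ltW.
have J_gt0 : (0 < J)%N by rewrite trunc_log_gt0.
split=> //; first by lra.
apply: (@le_trans _ _
    (\sum_(0 <= p < (2 ^ J.+1).+1 | prime p) (p%:R^-1 : R))).
  rewrite [leRHS](@big_cat_nat _ _ _ N.+1) //=; last first.
    by rewrite ltnS ltnW // trunc_log_ltn.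
  by rewrite lerDl sumr_ge0.
apply: le_trans (sum_inv_primes_pow2 R J) _.
rewrite -mulr_sumr.
have lnJ : ln J%:R <= ln (ln x) - c.
  rewrite lerBrDr -lnM ?posrE ?ltr0n // ler_ln ?posrE ?mulr_gt0 ?ltr0n //.
  rewrite mulr_natl -lnXn // ler_ln ?posrE ?exprn_gt0 //.
  by rewrite (le_trans _ leNx) // -natrX ler_nat trunc_logP // ltnW.
have := harmonic_le_ln R J_gt0.
have := ler_norm (- c); rewrite normrN => lec.
have lec1 : `|c| <= `|c| * ln (ln x) by rewrite ler_peMr.
rewrite mulrDl; lra.
Qed.

(** * Elementary bounds *)

Lemma sum_inv_sqr (R : realFieldType) (N P : nat) : (0 < N)%N ->
  \sum_(N.+1 <= n < P) (n%:R ^+ 2)^-1 <= N%:R^-1 :> R.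
Proof.
move=> N_gt0; have [leP|ltP] := leqP P N.+1.
  by rewrite big_geq // invr_ge0.
case: P ltP => // P; rewrite ltnS => ltNP.
apply: (@le_trans _ _ (N%:R^-1 - P%:R^-1)); last by rewrite gerBl invr_ge0.
rewrite big_add1 /= -[leRHS]opprB -(telescope_sumr (fun n => n%:R^-1));
  last exact: ltnW.
rewrite -sumrN; apply: ler_sum_nat => n /andP[leNn _].
have n0 : 0 < n%:R :> R by rewrite ltr0n (leq_trans N_gt0).
have n1 : 0 < n.+1%:R :> R by rewrite ltr0n.
rewrite opprB.
have -> : n%:R^-1 - n.+1%:R^-1 = (n%:R * n.+1%:R)^-1 :> R.
  have e : n.+1%:R = n%:R + 1 :> R by rewrite -addn1 natrD.
  rewrite e; field; rewrite -e; lra.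
rewrite lef_pV2 ?posrE ?exprn_gt0 ?mulr_gt0 //.
by rewrite expr2 ler_wpM2r ?(ltW n1) ?ler_nat.
Qed.

Lemma sum_inv_sqr_primes (R : realFieldType) (P : nat) :
  \sum_(0 <= p < P | prime p) (p%:R ^+ 2)^-1 <= 1 :> R.
Proof.
have := @sum_inv_sqr R 1 P isT; rewrite invr1; apply: le_trans.
have [leP|ltP] := leqP 2 P; last first.
  rewrite [leRHS]big_geq; last exact: ltnW.
  by case: P ltP => [|[|//]] _; rewrite big_mkcond ?big_nat1 ?big_geq.
rewrite (@big_cat_nat _ _ _ 2) //= [X in X + _]big_mkcond 2?big_nat_recr //=.
rewrite big_geq // !add0r big_mkcond; apply: ler_sum => n _; by case: ifP.
Qed.

Lemma sum_geometric_le (R : realFieldType) (q : R) (T : nat) :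
  0 <= q -> q < 1 -> \sum_(0 <= i < T) q ^+ i <= (1 - q)^-1.
Proof.
move=> q_ge0 q_lt1; have q1 : 0 < 1 - q by rewrite subr_gt0.
rewrite -[leRHS]mul1r ler_pdivlMr // mulrC big_mkord.
have := subrXX 1 q T; rewrite expr1n.
under [in X in _ = X -> _]eq_bigr do rewrite expr1n mul1r.
by move=> <-; rewrite gerBl exprn_ge0.
Qed.

(** [nu ^+ l] is dominated by any exponential; with the base 3/2 the terms are
dominated by a geometric progression of ratio 3/4. *)
Lemma sum_pow_half_bounded (R : realType) (l : nat) : exists B : R,
  0 <= B /\ forall T, \sum_(0 <= nu < T) nu%:R ^+ l / 2 ^+ nu <= B.
Proof.
(* [expR (a * nu) = (3 / 2) ^+ nu], and [y ^+ l <= l! expR y] with [y = a nu]. *)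
set a : R := ln (3 / 2).
have a_gt0 : 0 < a by rewrite ln_gt0 //; lra.
have Ea : expR a = 3 / 2 by rewrite lnK // posrE; lra.
have exp_ge (y : R) : 0 <= y -> y ^+ l <= l`!%:R * expR y.
  move=> y_ge0; case: l => [|l].
    by rewrite mul1r (le_trans _ (expR_ge1Dx y)) // lerDl.
  rewrite mulrC -ler_pdivrMr ?ltr0n ?fact_gt0 //.
  by apply: le_trans (expR_ge1Dxn l y_ge0); rewrite lerDr.
set c := l`!%:R / a ^+ l.
have c_ge0 : 0 <= c by rewrite divr_ge0 // exprn_ge0 // ltW.
exists (c * (1 - 3 / 4)^-1); split; first by rewrite mulr_ge0 // invr_ge0; lra.
move=> T; apply: (@le_trans _ _ (c * \sum_(0 <= nu < T) (3 / 4) ^+ nu)).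
  rewrite mulr_sumr; apply: ler_sum => nu _.
  have -> : (3 / 4) ^+ nu = (3 / 2) ^+ nu / 2 ^+ nu :> R.
    by rewrite -exprVn -exprMn; congr (_ ^+ _); lra.
  rewrite mulrA ler_pM2r ?invr_gt0 ?exprn_gt0 // -Ea -expRM_natl.
  rewrite /c mulrAC ler_pdivlMr ?exprn_gt0 // -exprMn.
  by apply: exp_ge; rewrite mulr_ge0 // ltW.
by rewrite ler_wpM2l // sum_geometric_le //; lra.
Qed.

(** A factor [p ^- 2] is split off, and [p] is replaced by 2 in what remains:
[p ^- e nu <= p ^- 2 * 2 ^- (nu - c)].  The factor [p ^- 2] makes the
subsequent sum over the primes converge, which is why the exponent must be at
least 2 already at [nu = c]. *)
Lemma sum_pow_prime_powers (R : realFieldType) (l c p T : nat) (e : nat -> nat)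
    (B : R) :
  (forall T, \sum_(0 <= nu < T) nu%:R ^+ l / 2 ^+ nu <= B) -> (2 <= p)%N ->
  (forall nu, (c <= nu)%N -> (nu - c + 2 <= e nu)%N) ->
  \sum_(c <= nu < T) nu%:R ^+ l / p%:R ^+ e nu <= 2 ^+ c * B / p%:R ^+ 2.
Proof.
move=> hB p_ge2 he.
have p0 : 0 < p%:R :> R by rewrite ltr0n ltnW.
have p1 : 1 <= p%:R :> R by rewrite ler1n ltnW.
have p2 : 2 <= p%:R :> R by rewrite (ler_nat _ 2).
have B_ge0 : 0 <= B by have := hB 0; rewrite big_geq.
have [leTc|ltcT] := leqP T c.
  by rewrite big_geq // divr_ge0 ?mulr_ge0 ?exprn_ge0 // ltW.
apply: (@le_trans _ _ (2 ^+ c / p%:R ^+ 2 *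
    \sum_(c <= nu < T) nu%:R ^+ l / 2 ^+ nu)); last first.
  rewrite [leRHS]mulrAC ler_wpM2l ?divr_ge0 ?exprn_ge0 ?(ltW p0) //.
  apply: le_trans (hB T).
  by rewrite [leRHS](@big_cat_nat _ _ _ c) //= ?(ltnW ltcT) // lerDr sumr_ge0.
rewrite mulr_sumr; apply: ler_sum_nat => nu /andP[lec _].
rewrite mulrCA ler_wpM2l ?exprn_ge0 //.
rewrite -[leRHS]invrK lef_pV2 ?posrE ?invr_gt0 ?mulr_gt0 ?invr_gt0 ?exprn_gt0 //.
apply: le_trans (ler_weXn2l p1 (he nu lec)).
rewrite exprD !invfM !invrK mulrAC ler_pM2r ?mulr_gt0 //.
rewrite -{1}(subnK lec) exprD mulrC -mulrA divff ?mulr1 ?gt_eqF ?exprn_gt0 //.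
by rewrite lerXn2r ?nnegrE // ltW.
Qed.

(** The mean value estimate for [y ^+ k.+1] on the interval from [floor y] to
[y = x / q], whose length is at most 1. *)
Lemma floor_pow_error (R : realType) (x : R) (q k : nat) :
  0 <= x -> (0 < q)%N ->
  `|((Num.truncn x %/ q) ^ k.+1)%:R - (x / q%:R) ^+ k.+1| <=
  k.+1%:R * (x / q%:R) ^+ k.
Proof.
move=> x_ge0 q_gt0; have q0 : 0 < q%:R :> R by rewrite ltr0n.
set y := x / q%:R; set m := (_ %/ q)%N; rewrite natrX.
have lemy : m%:R <= y.
  rewrite ler_pdivlMr // -natrM (@le_trans _ _ (Num.truncn x)%:R) //.
    by rewrite ler_nat leq_divM.
  by have /andP[] := truncn_itv x_ge0.
have ltym : y <= m.+1%:R.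
  rewrite ler_pdivrMr // -natrM (@le_trans _ _ (Num.truncn x).+1%:R) //.
    by rewrite ltW // truncnS_gt.
  by rewrite ler_nat ltn_ceil.
have y_ge0 : 0 <= y by rewrite (le_trans _ lemy).
rewrite distrC subrXX normrM ger0_norm ?subr_ge0 //.
apply: (@le_trans _ _ (1 * (\sum_(i < k.+1) y ^+ k))); last first.
  by rewrite mul1r sumr_const card_ord mulr_natl.
apply: ler_pM; rewrite ?subr_ge0 ?normr_ge0 //.
  by rewrite lerBlDl natr1.
rewrite ger0_norm ?sumr_ge0 // => [|i _]; last by rewrite mulr_ge0 ?exprn_ge0.
apply: ler_sum => i _ /=; have leik : (i <= k)%N by rewrite -ltnS.
rewrite -[in leRHS](subnK leik) exprD ler_wpM2l ?exprn_ge0 //.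
by rewrite lerXn2r ?nnegrE.
Qed.

(** * Convergence of complex series *)

Lemma normcR (R : rcfType) (r : R) : `|r%:C : R[i]| = `|r|%:C.
Proof. by rewrite normc_def /= expr0n /= addr0 sqrtr_sqr. Qed.

Lemma natrC (R : rcfType) (n : nat) : (n%:R)%:C = n%:R :> R[i].
Proof. exact: (rmorph_nat (real_complex R)). Qed.

Lemma normc_ge_Im (R : rcfType) (z : R[i]) : `|complex.Im z|%:C <= `|z|.
Proof.
have := normc_ge_Re (z * 'i%C); rewrite ReiNIm normrN normrM.
suff -> : `|'i%C : R[i]| = 1 by rewrite mulr1.
by rewrite normc_def /= expr0n /= add0r expr1n sqrtr1.
Qed.

Lemma cvg_real_complex (R : realType) (u : nat -> R) (l : R) :
  u n @[n --> \oo] --> l -> ((u n)%:C : Cplx R) @[n --> \oo] --> (l%:C : Cplx R).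
Proof.
move=> /cvgrPdist_le ul; apply/cvgrPdist_le => -[e e'].
rewrite ltcE /= => /andP[/eqP-> e_gt0].
near=> n; rewrite -(rmorphB (real_complex R)) normcR lecR.
by near: n; apply: ul.
Unshelve. all: by end_near. Qed.

(** The real and the imaginary parts are real series that converge absolutely;
their sums are recombined. *)
Lemma cvg_series_dominated (R : realType) (a : nat -> Cplx R) (b : nat -> R)
    (M : R) :
  (forall n, `|a n| <= (b n)%:C) ->
  (forall N, \sum_(0 <= n < N) b n <= M) ->
  cvgn (fun N => \sum_(0 <= n < N) a n).
Proof.
move=> le_ab le_bM.
have b_ge0 n : 0 <= b n by rewrite -ler0c; apply: le_trans (le_ab n).
have cvgb : cvgn (series b).
  apply: nondecreasing_is_cvgn.
    by apply: nondecreasing_series => n _ _.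
  by exists M => _ [n _ <-]; apply: le_bM.
have part (r : nat -> R) : (forall n, `|r n|%:C <= `|a n|) -> cvgn (series r).
  move=> le_ra; apply: (@normed_cvg R R^o).
  apply: series_le_cvg cvgb => // [n|n]; first exact: normr_ge0.
  by rewrite -lecR; apply: le_trans (le_ra n) (le_ab n).
have cvgRe := part _ (fun n => normc_ge_Re (a n)).
have cvgIm := part _ (fun n => normc_ge_Im (a n)).
suff -> : (fun N => \sum_(0 <= n < N) a n) =
    (fun N => (series (fun n => complex.Re (a n)) N)%:C : Cplx R) +
    (fun N => ('i%C : Cplx R) * (series (fun n => complex.Im (a n)) N)%:C).
  apply: is_cvgD.
    by apply: cvgP; apply: cvg_real_complex cvgRe.
  by apply: is_cvgMl_tmp; apply: cvgP; apply: cvg_real_complex cvgIm.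
apply/funext => N; rewrite fctE /series /= !(rmorph_sum (real_complex R)) /=.
rewrite mulr_sumr -big_split /=.
by apply: eq_bigr => n _; rewrite [LHS]complexE.
Qed.

(** The bounds live in [R[i]], which is only partially ordered; hence an epsilon
argument on norms instead of a comparison of limits. *)
Lemma cvg_norm_le (R : realType) (u : nat -> Cplx R) (l : Cplx R) (b : R[i])
    (n0 : nat) :
  u n @[n --> \oo] --> l -> (forall n, (n0 <= n)%N -> `|u n| <= b) -> `|l| <= b.
Proof.
move=> /cvgrPdist_le ul le_ub; apply/ler_addgt0Pr => e e_gt0.
near \oo => n.
rewrite -[l](subrK (u n)) addrC (le_trans (ler_normD _ _)) // lerD //.
  by apply: le_ub; near: n; exact: nbhs_infty_ge.
by near: n; apply: ul.
Unshelve. all: by end_near. Qed.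

Lemma cvg_series_dominated_cond (R : realType) (P : pred nat) (m : nat)
    (a : nat -> Cplx R) (b : nat -> R) (M : R) :
  (forall n, (m <= n)%N -> P n -> `|a n| <= (b n)%:C) ->
  (forall N, \sum_(m <= n < N | P n) b n <= M) ->
  cvgn (fun N => \sum_(m <= n < N | P n) a n).
Proof.
move=> le_ab le_bM.
pose restr (V : zmodType) (u : nat -> V) n := if P n && (m <= n)%N then u n else 0.
have sum_restr (V : zmodType) (u : nat -> V) N :
    \sum_(0 <= n < N) restr V u n = \sum_(m <= n < N | P n) u n.
  by rewrite -big_mkcond -big_nat_widenl.
rewrite -(funext (sum_restr _ a)).
apply: (@cvg_series_dominated _ _ (restr _ b) M) => [n|N].
  by rewrite /restr; case: ifP => [/andP[Pn len]|_]; [exact: le_ab|rewrite normr0].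
by rewrite sum_restr.
Qed.

(** * The series defining the constant *)

(** One polynomial bound for all exponents: the growth condition only concerns
exponents from 2 on, but [f p = 1] and [f 1 = 0] fit the same bound once the
constant is at least 1. *)
Lemma classF0_bound (R : realType) (f : nat -> Cplx R) : classF0 f ->
  exists (l : nat) (A : R), [/\ 0 <= A,
    forall p nu, prime p -> `|f (p ^ nu)%N| <= (A * nu%:R ^+ l)%:C &
    forall p nu, prime p -> (0 < nu)%N ->
      `|pp_diff f p nu| <= (A * nu%:R ^+ l)%:C].
Proof.
case=> fadd fp [l [C fC]]; have C_ge0 := normr_ge0 C.
have bound p nu : prime p -> `|f (p ^ nu)%N| <= ((`|C| + 1) * nu%:R ^+ l)%:C.
  move=> p_prime; case: nu => [|[|nu]].
  - by rewrite expn0 additive_fun1 // normr0 ler0c mulr_ge0 ?exprn_ge0 ?addr_ge0.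
  - by rewrite expn1 fp // normr1 expr1n mulr1 lecR lerDr.
  apply: le_trans (fC p nu.+2 p_prime isT) _; rewrite lecR ler_wpM2r ?exprn_ge0 //.
  by rewrite (le_trans (ler_norm C)) // lerDl.
have C1 : 0 <= `|C| + 1 by rewrite addr_ge0.
exists l, (2 * (`|C| + 1)); split=> [|p nu p_prime|p nu p_prime nu_gt0].
- by rewrite mulr_ge0.
- apply: le_trans (bound _ _ p_prime) _; rewrite lecR ler_wpM2r ?exprn_ge0 //.
  lra.
apply: le_trans (ler_normB _ _) _.
apply: le_trans (lerD (bound _ _ p_prime) (bound _ _ p_prime)) _.
rewrite -(rmorphD (real_complex R)) lecR /= -mulrA mulr_natl mulr2n lerD2l.
by rewrite ler_wpM2l // lerXn2r ?nnegrE // ler_nat leq_pred.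
Qed.

Lemma normc_invX (R : realType) (p e : nat) :
  `|(p%:R ^+ e)^-1 : Cplx R| = ((p%:R ^+ e)^-1)%:C.
Proof.
rewrite normfV normrX normr_nat (fmorphV (real_complex R)).
by rewrite rmorphXn rmorph_nat.
Qed.

(** Summation by parts in [nu]; the boundary term is [f 1 = 0]. *)
Lemma sum_pp_diff_by_parts (R : realType) (f : nat -> Cplx R)
    (k p T : nat) :
  additive_fun f ->
  \sum_(1 <= nu < T.+1) pp_diff f p nu / p%:R ^+ (nu * k) =
  \sum_(1 <= nu < T.+1) inner_term f k p nu -
  (p%:R ^+ k)^-1 * \sum_(1 <= nu < T) inner_term f k p nu.
Proof.
move=> fadd; case: T => [|T]; first by rewrite !big_geq // mulr0 subr0.
elim: T => [|T IH].
  rewrite !big_nat1 big_geq // mulr0 subr0 /pp_diff /inner_term expn0.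
  by rewrite additive_fun1 // subr0.
rewrite big_nat_recr //= IH [in RHS]big_nat_recr //=.
rewrite [in X in _ = _ - _ * X]big_nat_recr //= mulrDr opprD addrACA.
congr (_ + _); rewrite /pp_diff /inner_term mulrBl /=; congr (_ - _).
by rewrite mulrCA -invfM -exprD -mulSn.
Qed.

(** The factor [1 - p ^- k] in the constant is the trace of the passage from [f]
to its differences: shifting [nu] by one multiplies the inner series by
[p ^- k]. *)
Lemma cvg_prime_term (R : realType) (f : nat -> Cplx R) (k p : nat) :
  additive_fun f ->
  cvgn (fun N : nat => \sum_(1 <= nu < N) inner_term f k p nu) ->
  \sum_(1 <= nu < T) pp_diff f p nu / p%:R ^+ (nu * k) @[T --> \oo]
    --> prime_term f k p.
Proof.
move=> fadd cvgf; rewrite -cvg_shiftS /=.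
under eq_fun do rewrite sum_pp_diff_by_parts //.
rewrite /prime_term mulrBl mul1r; apply: cvgB; last exact: cvgMl_tmp.
rewrite (cvg_shiftS (fun N => \sum_(1 <= nu < N) inner_term f k p nu)).
exact: cvgf.
Qed.

Lemma cvg_sum_inner_term (R : realType) (f : nat -> Cplx R) (k p : nat) :
  classF0 f -> (2 <= k)%N -> prime p ->
  cvgn (fun N : nat => \sum_(1 <= nu < N) inner_term f k p nu).
Proof.
move=> /classF0_bound[l [A [A_ge0 fA _]]] k_ge2 p_prime.
have [B [B_ge0 hB]] := sum_pow_half_bounded R l.
apply: (@cvg_series_dominated_cond _ predT 1 _
  (fun nu => A * (nu%:R ^+ l / p%:R ^+ (nu * k))) (A * (2 ^+ 1 * B / p%:R ^+ 2))).
  move=> nu nu_gt0 _; rewrite normrM normc_invX mulrA.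
  rewrite (rmorphM (real_complex R)) ler_wpM2r ?fA //.
  by rewrite ler0c invr_ge0 exprn_ge0.
move=> N; rewrite -mulr_sumr ler_wpM2l //.
apply: (sum_pow_prime_powers (e := fun nu => (nu * k)%N) _ hB) => [|nu nu_gt0].
  exact: prime_gt1.
by apply: leq_trans (leq_mul (leqnn nu) k_ge2); lia.
Qed.

Lemma normc_prime_term_le (R : realType) (f : nat -> Cplx R) (k : nat) :
  classF0 f -> (2 <= k)%N -> exists K : R, 0 <= K /\
  forall p, prime p -> `|prime_term f k p| <= (K / p%:R ^+ 2)%:C.
Proof.
move=> hf k_ge2; have [fadd _ _] := hf.
have [l [A [A_ge0 _ fA]]] := classF0_bound hf.
have [B [B_ge0 hB]] := sum_pow_half_bounded R l.
exists (A * (2 ^+ 1 * B)); split; first by rewrite !mulr_ge0.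
move=> p p_prime.
apply: (cvg_norm_le (n0 := 0%N) (cvg_prime_term fadd (cvg_sum_inner_term hf k_ge2 p_prime))).
move=> T _; apply: le_trans (ler_norm_sum _ _ _) _.
apply: (@le_trans _ _
    (\sum_(1 <= nu < T) A * (nu%:R ^+ l / p%:R ^+ (nu * k)))%:C).
  rewrite (rmorph_sum (real_complex R)) /=; apply: ler_sum_nat => nu /andP[nu_gt0 _].
  rewrite normrM normc_invX mulrA (rmorphM (real_complex R)) ler_wpM2r ?fA //.
  by rewrite ler0c invr_ge0 exprn_ge0.
rewrite lecR -mulr_sumr -mulrA ler_wpM2l //.
apply: (sum_pow_prime_powers (e := fun nu => (nu * k)%N) _ hB) => [|nu nu_gt0].
  exact: prime_gt1.
by apply: leq_trans (leq_mul (leqnn nu) k_ge2); lia.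
Qed.

Lemma cvg_sum_prime_term (R : realType) (f : nat -> Cplx R) (k : nat) :
  classF0 f -> (2 <= k)%N ->
  cvgn (fun N : nat => \sum_(0 <= p < N | prime p) prime_term f k p).
Proof.
move=> hf k_ge2; have [K [K_ge0 hK]] := normc_prime_term_le hf k_ge2.
apply: (@cvg_series_dominated_cond _ prime 0 _ (fun p => K / p%:R ^+ 2) K).
  by move=> p _; apply: hK.
by move=> N; rewrite -mulr_sumr ler_piMr // sum_inv_sqr_primes.
Qed.

(** * The error of replacing the floor by the quotient *)

Definition pp_error (R : realType) (k : nat) (x : R) (q : nat) : R :=
  `|((Num.truncn x %/ q) ^ k)%:R - (x / q%:R) ^+ k|.

Lemma gcd_sum_approx (R : realType) (f : nat -> Cplx R) (k P T l : nat)
    (A x : R) :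
  additive_fun f -> (0 < k)%N ->
  (forall p nu, prime p -> (0 < nu)%N ->
    `|pp_diff f p nu| <= (A * nu%:R ^+ l)%:C) ->
  (Num.truncn x < P)%N -> (Num.truncn x < T)%N ->
  `|gcd_sum f k x - (\sum_(0 <= p < P | prime p) \sum_(1 <= nu < T)
      pp_diff f p nu / p%:R ^+ (nu * k)) * (x ^+ k)%:C| <=
  (\sum_(0 <= p < P | prime p) \sum_(1 <= nu < T)
      A * (nu%:R ^+ l * pp_error k x (p ^ nu)))%:C.
Proof.
move=> fadd k_gt0 fA ltNP ltNT; rewrite (gcd_sum_prime_powers fadd k_gt0 ltNP ltNT).
rewrite mulr_suml -sumrB (rmorph_sum (real_complex R)) /=.
apply: le_trans (ler_norm_sum _ _ _) _; apply: ler_sum => p p_prime.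
rewrite mulr_suml -sumrB (rmorph_sum (real_complex R)) /=.
apply: le_trans (ler_norm_sum _ _ _) _; apply: ler_sum_nat => nu /andP[nu_gt0 _].
have -> : pp_diff f p nu * ((Num.truncn x %/ p ^ nu) ^ k)%:R -
    pp_diff f p nu / p%:R ^+ (nu * k) * (x ^+ k)%:C =
    pp_diff f p nu * (((Num.truncn x %/ p ^ nu) ^ k)%:R -
      (x / (p ^ nu)%:R) ^+ k)%:C.
  rewrite (rmorphB (real_complex R)) /= natrC mulrBr; congr (_ - _).
  rewrite -mulrA; congr (_ * _).
  rewrite exprMn exprVn natrX -exprM (rmorphM (real_complex R)) mulrC; congr (_ * _).
  by rewrite (fmorphV (real_complex R)) rmorphXn rmorph_nat.
rewrite normrM normcR mulrA (rmorphM (real_complex R)) ler_wpM2r ?fA //.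
by rewrite ler0c normr_ge0.
Qed.

(** A bound on the truncated errors that is uniform in both truncations passes
to the limit, first [T] to infinity for fixed [P], then [P] to infinity. *)
Lemma gcd_sum_error (R : realType) (f : nat -> Cplx R) (k l : nat) (A x E : R) :
  classF0 f -> (2 <= k)%N ->
  (forall p nu, prime p -> (0 < nu)%N ->
    `|pp_diff f p nu| <= (A * nu%:R ^+ l)%:C) ->
  (forall P T, (Num.truncn x < P)%N -> (Num.truncn x < T)%N ->
    \sum_(0 <= p < P | prime p) \sum_(1 <= nu < T)
      A * (nu%:R ^+ l * pp_error k x (p ^ nu)) <= E) ->
  `|gcd_sum f k x - Dconst f k * (x ^+ k)%:C| <= E%:C.
Proof.
move=> hf k_ge2 fA leE; have [fadd _ _] := hf.
have sumP P : (Num.truncn x < P)%N ->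
    `|gcd_sum f k x -
      (\sum_(0 <= p < P | prime p) prime_term f k p) * (x ^+ k)%:C| <= E%:C.
  move=> ltNP.
  apply: (@cvg_norm_le _ (fun T => gcd_sum f k x - (\sum_(0 <= p < P | prime p)
    \sum_(1 <= nu < T) pp_diff f p nu / p%:R ^+ (nu * k)) * (x ^+ k)%:C)
    _ _ (Num.truncn x).+1).
    apply: cvgB; first exact: cvg_cst.
    apply: cvgMr_tmp; apply: cvg_big => [|p p_prime]; first exact: add_continuous.
    exact: (cvg_prime_term fadd (cvg_sum_inner_term hf k_ge2 p_prime)).
  move=> T ltNT.
  apply: le_trans (gcd_sum_approx fadd (ltnW k_ge2) fA ltNP ltNT) _.
  by rewrite lecR leE.
apply: (@cvg_norm_le _ (fun P => gcd_sum f k x -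
  (\sum_(0 <= p < P | prime p) prime_term f k p) * (x ^+ k)%:C)
  _ _ (Num.truncn x).+1 _ sumP).
apply: cvgB; first exact: cvg_cst.
apply: cvgMr_tmp; exact: (cvg_sum_prime_term hf k_ge2).
Qed.

Lemma sum_pp_error_prime_le (R : realType) (l c p T j : nat) (x B : R) :
  (forall T, \sum_(0 <= nu < T) nu%:R ^+ l / 2 ^+ nu <= B) ->
  0 <= x -> prime p ->
  (forall nu, (c <= nu)%N -> (nu - c + 2 <= nu * j)%N) ->
  \sum_(c <= nu < T) nu%:R ^+ l * pp_error j.+1 x (p ^ nu) <=
  j.+1%:R * x ^+ j * (2 ^+ c * B / p%:R ^+ 2).
Proof.
move=> hB x_ge0 p_prime hj.
apply: le_trans (ler_wpM2l _ (sum_pow_prime_powers T hB (prime_gt1 p_prime) hj));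
  last by rewrite mulr_ge0 ?exprn_ge0.
rewrite mulr_sumr; apply: ler_sum => nu _.
rewrite mulrCA ler_wpM2l ?exprn_ge0 //.
apply: le_trans (floor_pow_error j x_ge0 _) _; first by rewrite expn_gt0 prime_gt0.
by rewrite exprMn exprVn natrX -exprM mulrA.
Qed.

(** With [j = k - 1 >= 2] the bound [(x / p ^ nu) ^+ j] contains [p ^- 2] even
for [nu = 1], so nothing has to be known about the primes. *)
Lemma sum_pp_error_ge3 (R : realType) (l j : nat) (A B x : R) :
  (forall T, \sum_(0 <= nu < T) nu%:R ^+ l / 2 ^+ nu <= B) ->
  0 <= A -> 0 <= x -> (2 <= j)%N -> forall P T,
  \sum_(0 <= p < P | prime p) \sum_(1 <= nu < T)
    A * (nu%:R ^+ l * pp_error j.+1 x (p ^ nu)) <=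
  A * (j.+1%:R * (2 * B)) * x ^+ j.
Proof.
move=> hB A_ge0 x_ge0 j_ge2 P T.
have B_ge0 : 0 <= B by have := hB 0%N; rewrite big_geq.
set c := (leRHS); have c_ge0 : 0 <= c by rewrite !mulr_ge0 ?exprn_ge0.
apply: le_trans (ler_piMr c_ge0 (sum_inv_sqr_primes R P)).
rewrite mulr_sumr; apply: ler_sum => p p_prime; rewrite -mulr_sumr.
rewrite /c -!mulrA ler_wpM2l //.
have hj nu : (1 <= nu)%N -> (nu - 1 + 2 <= nu * j)%N.
  by move=> nu_gt0; apply: leq_trans (leq_mul (leqnn nu) j_ge2); lia.
apply: le_trans (sum_pp_error_prime_le T hB x_ge0 p_prime hj) _.
by rewrite expr1 le_eqVlt; apply/orP; left; apply/eqP; ring.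
Qed.

(** The linear bound [2 x / p] is used only for [p <= x], since its sum over all
primes diverges; beyond [x] the floor is 0 and the error is the quadratically small [(x / p) ^+ 2]. *)
Lemma sum_pp_error_primes (R : realType) (P : nat) (x M : R) : 1 <= x ->
  \sum_(0 <= p < (Num.truncn x).+1 | prime p) (p%:R^-1 : R) <= M ->
  (Num.truncn x < P)%N ->
  \sum_(0 <= p < P | prime p) pp_error 2 x p <= 2 * x * (M + 1).
Proof.
move=> x_ge1 hM ltNP; have x_ge0 : 0 <= x by rewrite (le_trans _ x_ge1).
set N := Num.truncn x in hM ltNP *.
have N_gt0 : (0 < N)%N by rewrite truncn_gt0.
have ltxN : x <= N.+1%:R by rewrite ltW // truncnS_gt.
have N0 : 0 < N%:R :> R by rewrite ltr0n.
rewrite (@big_cat_nat _ _ _ N.+1) //= mulrDr mulr1 lerD //.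
  apply: le_trans (ler_wpM2l _ hM); last by rewrite mulr_ge0.
  rewrite mulr_sumr; apply: ler_sum => p p_prime.
  apply: le_trans (floor_pow_error 1 x_ge0 (prime_gt0 p_prime)) _.
  by rewrite expr1 mulrA.
apply: (@le_trans _ _ (x ^+ 2 * N%:R^-1)).
  apply: le_trans (ler_wpM2l (exprn_ge0 2 x_ge0) (@sum_inv_sqr R N P N_gt0)).
  rewrite mulr_sumr big_mkcond; apply: ler_sum_nat => p /andP[ltNp _].
  case: ifP => _; last by rewrite mulr_ge0 ?exprn_ge0 // invr_ge0 exprn_ge0.
  rewrite /pp_error -/N divn_small // exp0n // sub0r normrN.
  by rewrite ger0_norm ?exprn_ge0 ?divr_ge0 // exprMn exprVn.
rewrite ler_pdivrMr // expr2 mulrAC ler_wpM2r //.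
(* [x <= N + 1 <= 2 N], as [N] is at least 1. *)
apply: le_trans ltxN _; rewrite -natrM ler_nat; lia.
Qed.

(** Only the primes themselves are delicate: from [nu = 2] on, [x / p ^ nu]
again contains the factor [p ^- 2]. *)
Lemma sum_pp_error_2 (R : realType) (l : nat) (A B M x : R) :
  (forall T, \sum_(0 <= nu < T) nu%:R ^+ l / 2 ^+ nu <= B) ->
  0 <= A -> 1 <= x ->
  \sum_(0 <= p < (Num.truncn x).+1 | prime p) (p%:R^-1 : R) <= M ->
  forall P T, (Num.truncn x < P)%N -> (Num.truncn x < T)%N ->
  \sum_(0 <= p < P | prime p) \sum_(1 <= nu < T)
    A * (nu%:R ^+ l * pp_error 2 x (p ^ nu)) <=
  A * (2 * x * (M + 1 + 4 * B)).
Proof.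
move=> hB A_ge0 x_ge1 hM P T ltNP ltNT.
have x_ge0 : 0 <= x by rewrite (le_trans _ x_ge1).
have B_ge0 : 0 <= B by have := hB 0%N; rewrite big_geq.
have T_gt1 : (1 < T)%N by rewrite (leq_trans _ ltNT) // ltnS truncn_gt0.
under eq_bigr do rewrite -mulr_sumr big_ltn // expr1n mul1r expn1.
rewrite -mulr_sumr ler_wpM2l // big_split /= mulrDr lerD ?sum_pp_error_primes //.
have c_ge0 : 0 <= 2 * x * (4 * B) by rewrite !mulr_ge0.
apply: le_trans (ler_piMr c_ge0 (sum_inv_sqr_primes R P)).
rewrite mulr_sumr; apply: ler_sum => p p_prime.
have hj nu : (2 <= nu)%N -> (nu - 2 + 2 <= nu * 1)%N by lia.
apply: le_trans (sum_pp_error_prime_le T hB x_ge0 p_prime hj) _.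
by rewrite le_eqVlt; apply/orP; left; apply/eqP; ring.
Qed.

(** The Landau notation quantifies over a constant of [R[i]] near [+oo]; a real
constant [K] is enough because every [c > K] is comparable with it. *)
Lemma eqaddO_infty (R : realType) (f g : R -> Cplx R) (h : R -> R) (K x0 : R) :
  (forall x, x0 <= x -> `|f x - g x| <= (K * h x)%:C) ->
  (forall x, x0 <= x -> 0 <= h x) ->
  f = g +O_ (at_infty R) (fun x => (h x)%:C : Cplx R).
Proof.
move=> hfg h_ge0; apply/eqaddOP; exists K%:C; split.
  by apply/complex_realP; exists K.
move=> c ltKc; exists x0; split=> [|x ltx]; first exact: num_real.
have hx := h_ge0 x (ltW ltx).
rewrite !fctE; apply: le_trans (hfg x (ltW ltx)) _.
rewrite normcR (ger0_norm hx) (rmorphM (real_complex R)).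
by rewrite ler_wpM2r ?ler0c // ltW.
Qed.

Theorem theorem2 (R : realType) (f : nat -> Cplx R) (k : nat)
    (hf : classF0 f) (hk : (2 <= k)%N) :
  [/\ forall p : nat, prime p ->
        cvgn (fun N : nat => \sum_(1 <= nu < N) inner_term f k p nu),
      cvgn (fun N : nat => \sum_(0 <= p < N | prime p) prime_term f k p),
      (3 <= k)%N ->
        gcd_sum f k = (fun x : R => Dconst f k * (x ^+ k)%:C)
          +O_ (at_infty R) (fun x : R => (x ^+ (k - 1))%:C : Cplx R)
    & k = 2%N ->
        gcd_sum f k = (fun x : R => Dconst f k * (x ^+ k)%:C)
          +O_ (at_infty R) (fun x : R => (x * ln (ln x))%:C : Cplx R)].
Proof.
have [l [A [A_ge0 _ fA]]] := classF0_bound hf.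
have [B [B_ge0 hB]] := sum_pow_half_bounded R l.
split=> [p p_prime||k_ge3|k2].
- exact: cvg_sum_inner_term.
- exact: cvg_sum_prime_term.
- case: k hk k_ge3 => // j hk j_ge2; rewrite subn1 /=.
  apply: (@eqaddO_infty _ _ _ _ (A * (j.+1%:R * (2 * B))) 0) => x x_ge0.
    apply: (gcd_sum_error hf hk fA) => P T _ _; exact: (sum_pp_error_ge3 hB).
  by rewrite exprn_ge0.
have [C [C_ge0 [x0 hC]]] := sum_inv_primes_lnln R.
rewrite k2 in hk *.
apply: (@eqaddO_infty _ _ _ _ (A * (2 * (C + 1 + 4 * B))) x0) => x lex.
  have [x_ge1 lnln_ge1 hM] := hC x lex.
  apply: (gcd_sum_error hf hk fA) => P T ltNP ltNT.
  apply: le_trans (sum_pp_error_2 hB A_ge0 x_ge1 hM ltNP ltNT) _.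
  rewrite -!mulrA ler_wpM2l // ler_wpM2l // mulrCA.
  rewrite ler_wpM2l ?(le_trans ler01) //.
  by have := ler_peMr B_ge0 lnln_ge1; lra.
have [x_ge1 lnln_ge1 _] := hC x lex.
by rewrite mulr_ge0 ?(le_trans ler01).
Qed.
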